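(* Let $\mathcal{P}\colon \mathbb{C}\hookrightarrow\mathbb{E}$ be a projective cover of an exact category $\mathbb{E}$. Suppose that one of the following (equivalent) conditions holds: \begin{enumerate} \item[(a)] for every object $U$ in $\mathbb{C}$, projective objects in $\mathbb{E}/\mathcal{P}U$ are internally projective; \item[(b)] the full subcategory $\mathrm{P}(\mathbb{E})$ of $\mathbb{E}$ on the projective objects (which is equivalent to the splitting of idempotents $\overline{\mathbb{C}}$ of $\mathbb{C}$) has pullbacks; \item[(c)] for every weak pullback $Z\xleftarrow{p_1}V\xrightarrow{p_2}X$ of a cospan $Z\to U\leftarrow X$ in $\mathbb{C}$ there is an idempotent $i\colon V\to V$ which is determined by projections and such that $p_1i=p_1$ and $p_2i=p_2$. \end{enumerate} Then $\mathbb{E}$ is locally cartesian closed if and only if $\mathbb{C}$ has weak dependent products.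
   Context: A category is exact if it has finite limits, regular epis are stable under pullback, and every equivalence relation $(r_1,r_2)\colon R\hookrightarrow X\times X$ has a coequaliser $q$ of $r_1,r_2$ such that $r_1,r_2$ is a kernel pair of $q$. An object $P$ of a category is (regular) projective if every arrow $P\to B$ lifts along every regular epi $A\to B$. A projective cover of an exact category $\mathbb{E}$ is (the inclusion $\mathcal{P}$ of) a full subcategory $\mathcal{P}\colon\mathbb{C}\hookrightarrow\mathbb{E}$ such that $\mathcal{P}X$ is projective in $\mathbb{E}$ for every $X$ in $\mathbb{C}$, and for every $A$ in $\mathbb{E}$ there are $X$ in $\mathbb{C}$ and a regular epi $\mathcal{P}X\to A$. In this situation $\mathbb{C}$ has weak finite limits. A weak limit is defined as a limit but without requiring uniqueness of the induced arrow. An object $P$ of a category with binary products is internally (regular) projective if for every object $C$, regular epi $r\colon A\to B$ and arrow $f\colon C\times P\to B$ there are an object $T$, a regular epi $t\colon T\to C$ and an arrow $f'\colon T\times P\to A$ with $rf'=f(t\times\mathrm{id}_P)$. An arrow $f\colon V\to Y$ out of a weak pullback with projections $p_1,p_2$ out of $V$ is determined by projections if, for all parallel arrows $h,k$ into $V$, $p_1h=p_1k$ and $p_2h=p_2k$ imply $fh=fk$. Weak dependent product: given arrows $Y\xrightarrow{g}X\xrightarrow{f}Z$ in $\mathbb{C}$, consider data $D=(W,w,V,p_1,p_2,e)$ where $w\colon W\to Z$, $X\xleftarrow{p_1}V\xrightarrow{p_2}W$ is a weak pullback of $f$ and $w$, and $e\colon V\to Y$ is determined by projections and satisfies $ge=p_1$.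 A weak dependent product of $g$ along $f$ is such a $D$ with the property that for every other such $D'=(W',w',V',p_1',p_2',e')$ there are $h\colon W'\to W$ and $k\colon V'\to V$ with $wh=w'$, $p_1k=p_1'$, $p_2k=hp_2'$, $ek=e'$. $\mathbb{C}$ has weak dependent products if every composable pair $Y\to X\to Z$ in $\mathbb{C}$ has a weak dependent product. *)

(* Defs.v *)
From mathcomp Require Import all_boot.
From Stdlib Require Import ProofIrrelevance.

Set Implicit Arguments.
Unset Strict Implicit.
Unset Printing Implicit Defensive.

Record category := Category {
  Ob :> Type;
  Hom : Ob -> Ob -> Type;
  id1 : forall A, Hom A A;
  comp : forall A B C, Hom B C -> Hom A B -> Hom A C;
  comp_id1l : forall A B (f : Hom A B), comp (id1 B) f = f;
  comp_id1r : forall A B (f : Hom A B), comp f (id1 A) = f;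
  compA : forall A B C D (h : Hom C D) (g : Hom B C) (f : Hom A B),
    comp h (comp g f) = comp (comp h g) f
}.

Arguments Hom {c} A B.
Arguments id1 {c} A.
Arguments comp {c A B C} g f.

Notation "g ∘ f" := (comp g f) (at level 40, left associativity).

Definition full_subcategory (E : category) (P : E -> Prop) : category :=
  @Category {X : E | P X}
    (fun X Y => @Hom E (proj1_sig X) (proj1_sig Y))
    (fun X => id1 (proj1_sig X))
    (fun _ _ _ g f => g ∘ f)
    (fun _ _ f => comp_id1l f)
    (fun _ _ f => comp_id1r f)
    (fun _ _ _ _ h g f => compA h g f).

Section Slice.
Variables (E : category) (U : E).

Definition slice_ob := {A : E & Hom A U}.
Definition slice_hom (a b : slice_ob) :=
  {h : Hom (projT1 a) (projT1 b) | projT2 b ∘ h = projT2 a}.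

Lemma slice_hom_eq (a b : slice_ob) (h k : slice_hom a b) :
  proj1_sig h = proj1_sig k -> h = k.
Proof.
case: h k => [h hh] [k hk] /= e; subst k.
by rewrite (proof_irrelevance _ hh hk).
Qed.

Definition slice_id (a : slice_ob) : slice_hom a a :=
  exist _ (id1 (projT1 a)) (comp_id1r (projT2 a)).

Lemma slice_comp_subproof (a b c : slice_ob)
    (g : slice_hom b c) (f : slice_hom a b) :
  projT2 c ∘ (proj1_sig g ∘ proj1_sig f) = projT2 a.
Proof. by rewrite compA (proj2_sig g) (proj2_sig f). Qed.

Definition slice_comp (a b c : slice_ob)
    (g : slice_hom b c) (f : slice_hom a b) : slice_hom a c :=
  exist _ (proj1_sig g ∘ proj1_sig f) (slice_comp_subproof g f).

Lemma slice_comp_idl (a b : slice_ob) (f : slice_hom a b) :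
  slice_comp (slice_id b) f = f.
Proof. by apply: slice_hom_eq; apply: comp_id1l. Qed.

Lemma slice_comp_idr (a b : slice_ob) (f : slice_hom a b) :
  slice_comp f (slice_id a) = f.
Proof. by apply: slice_hom_eq; apply: comp_id1r. Qed.

Lemma slice_compA (a b c d : slice_ob)
    (h : slice_hom c d) (g : slice_hom b c) (f : slice_hom a b) :
  slice_comp h (slice_comp g f) = slice_comp (slice_comp h g) f.
Proof. by apply: slice_hom_eq; apply: compA. Qed.

Definition slice : category :=
  Category slice_comp_idl slice_comp_idr slice_compA.

End Slice.

(* A diagram is indexed by a finite directed graph: cones over a functor from
   a finite category are cones over the underlying graph, since the composition
   laws of the index category play no role in the cone condition. *)
Record finite_diagram (C : category) := FiniteDiagram {
  vertex : finType;
  edge : finType;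
  src : edge -> vertex;
  tgt : edge -> vertex;
  dob : vertex -> C;
  dhom : forall e : edge, Hom (dob (src e)) (dob (tgt e))
}.

Definition is_cone (C : category) (D : finite_diagram C) (L : C)
    (p : forall v : vertex D, Hom L (dob v)) : Prop :=
  forall e : edge D, dhom e ∘ p (src e) = p (tgt e).

Definition is_limit (C : category) (D : finite_diagram C) (L : C)
    (p : forall v : vertex D, Hom L (dob v)) : Prop :=
  is_cone p /\
  forall (M : C) (q : forall v : vertex D, Hom M (dob v)), is_cone q ->
    exists! u : Hom M L, forall v, p v ∘ u = q v.

Definition has_finite_limits (C : category) : Prop :=
  forall D : finite_diagram C,
    exists (L : C) (p : forall v : vertex D, Hom L (dob v)), is_limit p.

Section Notions.
Variable C : category.
Implicit Types A B X Y Z T V W P Q R : C.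

Definition is_terminal T : Prop := forall A, exists! u : Hom A T, True.

Definition has_terminal : Prop := exists T, is_terminal T.

Definition is_product A B P (p1 : Hom P A) (p2 : Hom P B) : Prop :=
  forall Q (q1 : Hom Q A) (q2 : Hom Q B),
    exists! u : Hom Q P, p1 ∘ u = q1 /\ p2 ∘ u = q2.

Definition has_binary_products : Prop :=
  forall A B, exists P (p1 : Hom P A) (p2 : Hom P B), is_product p1 p2.

Definition is_pullback X Y Z (f : Hom X Z) (g : Hom Y Z)
    P (p1 : Hom P X) (p2 : Hom P Y) : Prop :=
  f ∘ p1 = g ∘ p2 /\
  forall Q (q1 : Hom Q X) (q2 : Hom Q Y), f ∘ q1 = g ∘ q2 ->
    exists! u : Hom Q P, p1 ∘ u = q1 /\ p2 ∘ u = q2.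

Definition has_pullbacks : Prop :=
  forall X Y Z (f : Hom X Z) (g : Hom Y Z),
    exists P (p1 : Hom P X) (p2 : Hom P Y), is_pullback f g p1 p2.

Definition is_weak_pullback X Y Z (f : Hom X Z) (g : Hom Y Z)
    V (p1 : Hom V X) (p2 : Hom V Y) : Prop :=
  f ∘ p1 = g ∘ p2 /\
  forall Q (q1 : Hom Q X) (q2 : Hom Q Y), f ∘ q1 = g ∘ q2 ->
    exists u : Hom Q V, p1 ∘ u = q1 /\ p2 ∘ u = q2.

Definition is_coequaliser A B (k1 k2 : Hom A B) Q (q : Hom B Q) : Prop :=
  q ∘ k1 = q ∘ k2 /\
  forall T (t : Hom B T), t ∘ k1 = t ∘ k2 -> exists! u : Hom Q T, u ∘ q = t.

Definition regular_epi A B (r : Hom A B) : Prop :=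
  exists K (k1 k2 : Hom K A), is_coequaliser k1 k2 r.

Definition jointly_monic R X Y (r1 : Hom R X) (r2 : Hom R Y) : Prop :=
  forall A (h k : Hom A R), r1 ∘ h = r1 ∘ k -> r2 ∘ h = r2 ∘ k -> h = k.

Record equivalence_relation R X (r1 r2 : Hom R X) : Prop := {
  eqrel_mono : jointly_monic r1 r2;
  eqrel_refl : exists d : Hom X R, r1 ∘ d = id1 X /\ r2 ∘ d = id1 X;
  eqrel_sym : exists s : Hom R R, r1 ∘ s = r2 /\ r2 ∘ s = r1;
  eqrel_trans : forall P (p1 p2 : Hom P R), is_pullback r2 r1 p1 p2 ->
    exists m : Hom P R, r1 ∘ m = r1 ∘ p1 /\ r2 ∘ m = r2 ∘ p2
}.

Record exact : Prop := {
  exact_finite_limits : has_finite_limits C;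
  exact_regular_epi_stable :
    forall A B X (r : Hom A B) (f : Hom X B) P (p1 : Hom P X) (p2 : Hom P A),
      is_pullback f r p1 p2 -> regular_epi r -> regular_epi p1;
  exact_effective : forall R X (r1 r2 : Hom R X), equivalence_relation r1 r2 ->
    exists Q (q : Hom X Q), is_coequaliser r1 r2 q /\ is_pullback q q r1 r2
}.

Definition projective P : Prop :=
  forall A B (r : Hom A B), regular_epi r ->
  forall f : Hom P B, exists f' : Hom P A, r ∘ f' = f.

(* [u] is the arrow [t × id] between a product [T × P] with projections
   [t1, t2] and a product [X × P] with projections [x1, x2]. *)
Definition is_times_id T X P (t : Hom T X)
    TP (t1 : Hom TP T) (t2 : Hom TP P) XP (x1 : Hom XP X) (x2 : Hom XP P)
    (u : Hom TP XP) : Prop :=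
  x1 ∘ u = t ∘ t1 /\ x2 ∘ u = t2.

Definition internally_projective P : Prop :=
  forall X A B (r : Hom A B), regular_epi r ->
  forall XP (x1 : Hom XP X) (x2 : Hom XP P), is_product x1 x2 ->
  forall f : Hom XP B,
  exists T (t : Hom T X), regular_epi t /\
  exists TP (t1 : Hom TP T) (t2 : Hom TP P), is_product t1 t2 /\
  exists u : Hom TP XP, is_times_id t t1 t2 x1 x2 u /\
  exists f' : Hom TP A, r ∘ f' = f ∘ u.

Definition is_exponential A B X
    XA (x1 : Hom XA X) (x2 : Hom XA A) (ev : Hom XA B) : Prop :=
  is_product x1 x2 /\
  forall T TA (t1 : Hom TA T) (t2 : Hom TA A), is_product t1 t2 ->
  forall f : Hom TA B,
    exists! g : Hom T X,
      exists u : Hom TA XA, is_times_id g t1 t2 x1 x2 u /\ ev ∘ u = f.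

Definition has_exponentials : Prop :=
  forall A B, exists X XA (x1 : Hom XA X) (x2 : Hom XA A) (ev : Hom XA B),
    is_exponential x1 x2 ev.

Definition cartesian_closed : Prop :=
  [/\ has_terminal, has_binary_products & has_exponentials].

Definition determined_by_projections X W V (p1 : Hom V X) (p2 : Hom V W)
    Y (f : Hom V Y) : Prop :=
  forall A (h k : Hom A V), p1 ∘ h = p1 ∘ k -> p2 ∘ h = p2 ∘ k ->
    f ∘ h = f ∘ k.

Record dep_prod_data Y X Z (g : Hom Y X) (f : Hom X Z) := DepProdData {
  dp_W : C;
  dp_w : Hom dp_W Z;
  dp_V : C;
  dp_p1 : Hom dp_V X;
  dp_p2 : Hom dp_V dp_W;
  dp_weak_pullback : is_weak_pullback f dp_w dp_p1 dp_p2;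
  dp_e : Hom dp_V Y;
  dp_determined : determined_by_projections dp_p1 dp_p2 dp_e;
  dp_over : g ∘ dp_e = dp_p1
}.

Definition is_weak_dependent_product Y X Z (g : Hom Y X) (f : Hom X Z)
    (D : dep_prod_data g f) : Prop :=
  forall D' : dep_prod_data g f,
  exists (h : Hom (dp_W D') (dp_W D)) (k : Hom (dp_V D') (dp_V D)),
    [/\ dp_w D ∘ h = dp_w D', dp_p1 D ∘ k = dp_p1 D',
        dp_p2 D ∘ k = h ∘ dp_p2 D' & dp_e D ∘ k = dp_e D'].

Definition has_weak_dependent_products : Prop :=
  forall Y X Z (g : Hom Y X) (f : Hom X Z),
    exists D : dep_prod_data g f, is_weak_dependent_product D.

Definition weak_pullbacks_have_idempotents : Prop :=
  forall Z U X (f : Hom Z U) (g : Hom X U) V (p1 : Hom V Z) (p2 : Hom V X),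
    is_weak_pullback f g p1 p2 ->
    exists i : Hom V V,
      [/\ i ∘ i = i, determined_by_projections p1 p2 i,
          p1 ∘ i = p1 & p2 ∘ i = p2].

End Notions.

Arguments dep_prod_data {C Y X Z} g f.

Definition locally_cartesian_closed (E : category) : Prop :=
  forall U : E, cartesian_closed (slice U).

(* The full subcategory is given by the predicate [P] selecting its objects. *)
Definition projective_cover (E : category) (P : E -> Prop) : Prop :=
  (forall X : E, P X -> projective X) /\
  (forall A : E, exists2 X : E, P X & exists r : Hom X A, regular_epi r).

Definition projectives (E : category) : category :=
  full_subcategory (@projective E).

Definition slice_projectives_internally_projective
    (E : category) (P : E -> Prop) : Prop :=
  forall U : full_subcategory P, forall Q : slice (proj1_sig U),
    projective Q -> internally_projective Q.

(* Main.v *)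
(* Everything is tested on elements [D -> A] with stage [D] in the projective
   cover: such elements detect equality, regular epis are the arrows along
   which they lift, and natural families of maps between them come from
   arrows.  Each of (a), (b), (c) says that the pullback in [E] of a cospan of
   objects of the cover is projective.

   From exponentials in slices, a weak dependent product of [g] along [f] is a
   cover of the equaliser cutting the sections of [g] out of an exponential.
   Conversely, since the pullbacks [X ×_Z W] are projective, weak dependent
   products lift to families with values in an arbitrary object of [E].  The
   image of one of them is the universal quantification of an equation along
   an arrow, which serves twice: to cut out of a weak exponential of a cover of
   [A] the families that descend to [A], and to define the equivalence relation
   "equal as functions", whose quotient is the exponential. *)

From mathcomp Require Import all_boot.
Require Import Defs.

Set Implicit Arguments.
Unset Strict Implicit.
Unset Printing Implicit Defensive.

(* Congruence closure modulo associativity and identities: composites are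
   nested to the right, and every equation between arrows in the context is
   supplemented by its universally quantified precomposite. *)
Ltac precompose f x :=
  lazymatch f with
  | ?g ∘ ?h => let hx := precompose h x in constr:(g ∘ hx)
  | id1 _ => x
  | _ => constr:(f ∘ x)
  end.

Ltac add_precomposite e :=
  lazymatch type of e with
  | @eq (@Hom ?C ?A _) ?f ?g =>
    let T := fresh "T" in let x := fresh "x" in
    let S := constr:(forall (T : C) (x : @Hom C T A), ltac:(
      let fx := precompose f x in let gx := precompose g x in
      exact (fx = gx))) in
    have : S by intros T x; have := congr1 (fun h => h ∘ x) e;
      rewrite -?compA ?comp_id1l
  end.

Ltac cat_normalise :=
  repeat match goal with
  | H : @eq (@Hom _ _ _) _ _ |- _ =>
    rewrite -?compA ?comp_id1l ?comp_id1r in H; move: H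
  end;
  rewrite -?compA ?comp_id1l ?comp_id1r;
  intros;
  repeat match goal with
  | H : @eq (@Hom _ _ _) (_ ∘ _) (id1 ?A) |- _ =>
    add_precomposite H; move: (@comp_id1r _ A); revert H
  | H : @eq (@Hom _ _ _) (_ ∘ _) _ |- _ => add_precomposite H; revert H
  | H : @eq (@Hom _ _ _) _ (_ ∘ _) |- _ =>
    add_precomposite (esym H); revert H
  end; intros.

Ltac cat := solve [cat_normalise; congruence].

(** * Universal properties *)

Section Universal.
Variable C : category.
Implicit Types A B K P Q T X Y Z : C.

Definition monic A B (m : Hom A B) : Prop :=
  forall T (h k : Hom T A), m ∘ h = m ∘ k -> h = k.

Lemma pb_lift X Y Z (f : Hom X Z) (g : Hom Y Z) P (p1 : Hom P X) (p2 : Hom P Y) :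
  is_pullback f g p1 p2 -> forall Q (q1 : Hom Q X) (q2 : Hom Q Y),
  f ∘ q1 = g ∘ q2 -> exists u, p1 ∘ u = q1 /\ p2 ∘ u = q2.
Proof. by move=> [_ pb] Q q1 q2 /pb [u [uP _]]; exists u. Qed.

Lemma pb_ext X Y Z (f : Hom X Z) (g : Hom Y Z) P (p1 : Hom P X) (p2 : Hom P Y) :
  is_pullback f g p1 p2 -> jointly_monic p1 p2.
Proof.
move=> [sq pb] Q h k e1 e2.
have [|u [_ uniq]] := pb Q (p1 ∘ h) (p2 ∘ h); first by cat.
by rewrite -(uniq h) ?(uniq k); split.
Qed.

Lemma pb_sym X Y Z (f : Hom X Z) (g : Hom Y Z) P (p1 : Hom P X) (p2 : Hom P Y) :
  is_pullback f g p1 p2 -> is_pullback g f p2 p1.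
Proof.
move=> [sq pb]; split=> [|Q q1 q2 e]; first by rewrite sq.
have [u [[u1 u2] uniq]] := pb _ _ _ (esym e).
by exists u; split=> // v [v1 v2]; apply: uniq.
Qed.

Lemma coeq_desc A B (k1 k2 : Hom A B) Q (q : Hom B Q) :
  is_coequaliser k1 k2 q -> forall T (t : Hom B T),
  t ∘ k1 = t ∘ k2 -> exists u, u ∘ q = t.
Proof. by move=> [_ ce] T t /ce [u [uq _]]; exists u. Qed.

Lemma coeq_ext A B (k1 k2 : Hom A B) Q (q : Hom B Q) :
  is_coequaliser k1 k2 q -> forall T (u v : Hom Q T), u ∘ q = v ∘ q -> u = v.
Proof.
move=> [sq ce] T u v e; have [|w [_ uniq]] := ce T (u ∘ q); first by cat.
by rewrite -(uniq u) ?(uniq v).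
Qed.

Lemma projective_lift T A B (r : Hom A B) (f : Hom T B) :
  projective T -> regular_epi r -> exists f' : Hom T A, r ∘ f' = f.
Proof. by move=> projT /projT. Qed.

Lemma retract_projective A B (s : Hom A B) (r : Hom B A) :
  r ∘ s = id1 A -> projective B -> projective A.
Proof.
move=> rs projB X Y q rq f; have [g gE] := projB _ _ q rq (f ∘ r).
by exists (g ∘ s); cat.
Qed.

Lemma finite_limits_pullbacks : has_finite_limits C -> has_pullbacks C.
Proof.
move=> lim X Y Z f g.
pose dob (v : option bool) := match v with
  | Some true => X | Some false => Y | None => Z end.
pose dhom (e : bool) : Hom (dob (Some e)) (dob None) :=
  match e with true => f | false => g end.
have [L [p [cone univ]]] := lim (FiniteDiagram dhom).
exists L, (p (Some true)), (p (Some false)).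
split=> [|Q q1 q2 sq]; first by rewrite (cone true) (cone false).
pose q v : Hom Q (dob v) := match v with
  | Some true => q1 | Some false => q2 | None => f ∘ q1 end.
have [|u [uP uniq]] := univ Q q; first by case.
exists u; split=> [|v [v1 v2]].
  by split; [apply: (uP (Some true)) | apply: (uP (Some false))].
by apply: uniq => -[[]|] //=; rewrite -(cone true) -compA v1.
Qed.

Lemma finite_limits_equalisers : has_finite_limits C ->
  forall A B (f g : Hom A B), exists S (i : Hom S A),
    [/\ f ∘ i = g ∘ i, monic i &
        forall T (t : Hom T A), f ∘ t = g ∘ t -> exists u, i ∘ u = t].
Proof.
move=> lim A B f g.
pose dob (v : bool) := if v then A else B.
pose D := @FiniteDiagram C bool bool (fun=> true) (fun=> false) dob
  (fun e => if e then f else g).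
have [L [p [cone univ]]] := lim D.
have cf : f ∘ p true = p false := cone true.
have cg : g ∘ p true = p false := cone false.
(* Naming the projection at the type [Hom L A] hides the dependent family [dob] from later
   rewriting. *)
have [i iE] : {i : Hom L A | i = p true} by exists (p true).
rewrite -iE in cf cg.
have sq : f ∘ i = g ∘ i by rewrite cf cg.
have lift T (t : Hom T A) : f ∘ t = g ∘ t -> exists! u : Hom T L, i ∘ u = t.
  move=> e; pose q v : Hom T (dob v) :=
    match v with true => t | false => f ∘ t end.
  have [|u [uP uniq]] := univ T q; first by case.
  exists u; split=> [|v vE]; first by rewrite iE (uP true).
  have fv : f ∘ (i ∘ v) = f ∘ t by rewrite vE.
  by apply: uniq => -[]; [rewrite iE in vE | rewrite compA cf in fv].
exists L, i; split=> // [T h k e|T t /lift [u [uP _]]]; last by exists u.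
have [|u [_ uniq]] := lift T (i ∘ h); first by cat.
by rewrite -(uniq h) ?(uniq k).
Qed.

End Universal.

(** * Elements with stage in a projective cover *)

Section ProjectiveCover.
Variables (E : category) (P : E -> Prop).
Hypotheses (exactE : exact E) (coverP : projective_cover P).
Implicit Types A B D K Q R S T U V W X Y Z : E.

Let pullbacks : has_pullbacks E :=
  finite_limits_pullbacks (exact_finite_limits exactE).

Definition P_lifting A B (r : Hom A B) : Prop :=
  forall D (f : Hom D B), P D -> exists f' : Hom D A, r ∘ f' = f.

Lemma P_projective D : P D -> projective D.
Proof. by case: coverP => projP _; apply: projP. Qed.

Lemma regular_epi_lifting A B (r : Hom A B) : regular_epi r -> P_lifting r.
Proof. by move=> rr D f PD; apply: projective_lift rr; apply: P_projective. Qed.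

Lemma regular_epi_ext A B (r : Hom A B) : regular_epi r ->
  forall T (u v : Hom B T), u ∘ r = v ∘ r -> u = v.
Proof. by move=> [K [k1 [k2 ce]]]; apply: coeq_ext ce. Qed.

Lemma P_cover A : exists X (r : Hom X A), P X /\ regular_epi r.
Proof. by have [X PX [r rr]] := coverP.2 A; exists X, r. Qed.

(** A cover of [A] by an object of [P] is itself such an element, and regular epis cancel on the
    right. *)
Lemma P_ext A B (f g : Hom A B) :
  (forall D (x : Hom D A), P D -> f ∘ x = g ∘ x) -> f = g.
Proof.
by move=> e; have [X [r [PX rr]]] := P_cover A; apply: (regular_epi_ext rr); apply: e.
Qed.

Lemma P_monic A B (m : Hom A B) :
  (forall D (h k : Hom D A), P D -> m ∘ h = m ∘ k -> h = k) -> monic m.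
Proof.
move=> mono T h k e; apply: P_ext => D x PD; apply: mono => //.
by rewrite !compA e.
Qed.

(* Arrows out of [V] correspond to natural families of maps on the elements of
   [V] with stage in [P], because a cover of [V] by such a stage is the
   coequaliser of its kernel pair. *)
Lemma hom_of_P_elements V B (F : forall D, Hom D V -> Hom D B -> Prop) :
  (forall D D' (k : Hom D' D) v b, P D -> P D' ->
     F D v b -> F D' (v ∘ k) (b ∘ k)) ->
  (forall D (v : Hom D V), P D -> exists b, F D v b) ->
  (forall D (v : Hom D V) b b', P D -> F D v b -> F D v b' -> b = b') ->
  exists e : Hom V B, forall D (v : Hom D V), P D -> F D v (e ∘ v).
Proof.
move=> nat total functional.
have [X [c [PX cc]]] := P_cover V; have [b Fb] := total _ c PX.
have [K [k1 [k2 ce]]] := cc.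
have [|e eE] := coeq_desc ce (t := b).
  apply: P_ext => D x PD; apply: (functional D (c ∘ k1 ∘ x)) => //.
    by rewrite -!compA; apply: nat.
  by rewrite ce.1 -!compA; apply: nat.
exists e => D v PD; have [v' <-] := regular_epi_lifting cc v PD.
by rewrite compA eE; apply: nat.
Qed.

(** Monicity makes the local factorisations unique, hence natural in the stage, so they come from
    one arrow. *)
Lemma monic_factor A B T (m : Hom A B) (t : Hom T B) : monic m ->
  (forall D (y : Hom D T), P D -> exists z, m ∘ z = t ∘ y) ->
  exists u, m ∘ u = t.
Proof.
move=> mono lift; pose F D (y : Hom D T) (z : Hom D A) := m ∘ z = t ∘ y.
have [D D' k y z _ _ e|D y|D y z z' _ e e'|u uP] := @hom_of_P_elements T A F.
- by rewrite /F in e *; cat.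
- exact: lift.
- by apply: mono; rewrite e e'.
by exists u; apply: P_ext => D y PD; rewrite -compA uP.
Qed.

(** The value at an element of [B] is that of [t] at any lift along [r]; compatibility makes the
    choice of lift immaterial. *)
Lemma lifting_desc A B (r : Hom A B) T (t : Hom A T) : P_lifting r ->
  (forall D (h k : Hom D A), P D -> r ∘ h = r ∘ k -> t ∘ h = t ∘ k) ->
  exists u : Hom B T, u ∘ r = t.
Proof.
move=> lift comp.
pose F D (y : Hom D B) (z : Hom D T) := exists2 x, r ∘ x = y & t ∘ x = z.
have [D D' k y z _ _ [x <- <-]|D y PD|D y z z' PD|u uP] := @hom_of_P_elements B T F.
- by exists (x ∘ k); rewrite compA.
- by have [x xE] := lift D y PD; exists (t ∘ x), x.
- by move=> [x xE <-] [x' xE' <-]; apply: comp; rewrite ?xE.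
exists u; apply: P_ext => D x PD; have [x' e1 e2] := uP D (r ∘ x) PD.
by rewrite -compA -e2; apply: comp.
Qed.

Lemma lifting_ext A B (r : Hom A B) T (u v : Hom B T) : P_lifting r ->
  u ∘ r = v ∘ r -> u = v.
Proof.
move=> lift e; apply: P_ext => D y PD.
by have [x <-] := lift D y PD; rewrite !compA e.
Qed.

(** Converse of [regular_epi_lifting]: two elements identified by [r] form an element of its kernel
    pair, so [lifting_desc] makes [r] the coequaliser of that pair. *)
Lemma lifting_regular_epi A B (r : Hom A B) : P_lifting r -> regular_epi r.
Proof.
move=> lift; have [K [k1 [k2 pb]]] := pullbacks r r.
exists K, k1, k2; split=> [|T t e]; first exact: pb.1.
have [|u uE] := lifting_desc (t := t) lift.
  move=> D h k _ rhk; have [w [w1 w2]] := pb_lift pb rhk; cat.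
by exists u; split=> // v vE; apply: (lifting_ext lift); rewrite uE.
Qed.

(** [Q] is the quotient of [A] by the kernel pair of [f]. Elements of [Q] lift to [A]; if [m]
    identifies them, their lifts form an element of the kernel pair, which [q] collapses. *)
Lemma image A B (f : Hom A B) :
  exists Q (q : Hom A Q) (m : Hom Q B), [/\ regular_epi q, monic m & m ∘ q = f].
Proof.
have [K [k1 [k2 pb]]] := pullbacks f f.
have eqr : equivalence_relation k1 k2.
  split; first exact: pb_ext pb.
  - by have [d dP] := pb_lift pb (erefl (f ∘ id1 A)); exists d.
  - by have [d dP] := pb_lift pb (esym pb.1); exists d.
  move=> T p1 p2 pbT; have e := pbT.1.
  have sq := pb.1.
  by have [|d dP] := pb_lift pb (q1 := k1 ∘ p1) (q2 := k2 ∘ p2); [cat|exists d].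
have [Q [q [ce pbq]]] := exact_effective exactE eqr.
have qq : regular_epi q by exists K, k1, k2.
have [m mE] := coeq_desc ce pb.1; exists Q, q, m; split=> //.
apply: P_monic => D h k PD.
have [h' <-] := regular_epi_lifting qq h PD.
have [k' <-] := regular_epi_lifting qq k PD => e.
have [|w [w1 w2]] := pb_lift pb (q1 := h') (q2 := k'); first by cat.
by have := ce.1; cat.
Qed.

Lemma projective_retract Q : projective Q ->
  exists X (r : Hom X Q) (s : Hom Q X), P X /\ r ∘ s = id1 Q.
Proof.
move=> projQ; have [X [r [PX rr]]] := P_cover Q.
by have [s sE] := projective_lift (id1 Q) projQ rr; exists X, r, s.
Qed.


(** * Projectivity of pullbacks *)

Definition P_pullbacks_projective : Prop :=
  forall Z U X (f : Hom Z U) (g : Hom X U) V (p1 : Hom V Z) (p2 : Hom V X),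
    P Z -> P U -> P X -> is_pullback f g p1 p2 -> projective V.

(** Splitting covers exhibits the cospan as a retract of a cospan in [P], and pullback preserves
    retracts. *)
Lemma pullback_of_projectives (KP : P_pullbacks_projective)
    Z U X (f : Hom Z U) (g : Hom X U) V (p1 : Hom V Z) (p2 : Hom V X) :
  projective Z -> projective U -> projective X -> is_pullback f g p1 p2 ->
  projective V.
Proof.
move=> /projective_retract [Z0 [rz [sz [PZ ez]]]].
move=> /projective_retract [U0 [ru [su [PU eu]]]].
move=> /projective_retract [X0 [rx [sx [PX ex]]]] pb; have sq := pb.1.
have [V0 [q1 [q2 pb0]]] := pullbacks (su ∘ f ∘ rz) (su ∘ g ∘ rx).
have sq0 := pb0.1.
have projV0 : projective V0 by apply: KP pb0.
have [|s [s1 s2]] := pb_lift pb0 (q1 := sz ∘ p1) (q2 := sx ∘ p2); first by cat.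
have [|r [r1 r2]] := pb_lift pb (q1 := rz ∘ q1) (q2 := rx ∘ q2).
  have : ru ∘ (su ∘ f ∘ rz ∘ q1) = ru ∘ (su ∘ g ∘ rx ∘ q2) by rewrite sq0.
  by cat.
apply: (@retract_projective _ _ _ s r _ projV0).
by apply: (pb_ext pb); cat.
Qed.

(** From left to right, [L] is a pullback against projective stages only. The arrow to [L] from a
    cover of [V] still descends to [V], which exhibits [V] as a retract of [L]. *)
Lemma projectives_pullbacks :
  has_pullbacks (projectives E) <-> P_pullbacks_projective.
Proof.
split=> [pbs Z U X f g V p1 p2 PZ PU PX pb|KP].
  have sq := pb.1.
  pose ob A (PA : P A) : projectives E := exist _ A (P_projective PA).
  have [[L projL] [l1 [l2 pbL]]] := pbs (ob Z PZ) (ob X PX) (ob U PU) f g.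
  rewrite /= in l1 l2 pbL.
  have [Q [c [PQ cc]]] := P_cover V.
  have [u [u1 u2]] : exists u : Hom Q L, l1 ∘ u = p1 ∘ c /\ l2 ∘ u = p2 ∘ c.
    by apply: (pb_lift pbL (Q := ob Q PQ)); rewrite /=; cat.
  have [|s sE] := lifting_desc (t := u) (regular_epi_lifting cc).
    move=> D h k PD e.
    by apply: (pb_ext pbL (A := ob D PD)); rewrite /=; cat.
  have [r [r1 r2]] := pb_lift pb pbL.1; rewrite /= in r r1 r2.
  apply: (@retract_projective _ _ _ s r _ projL).
  by apply: (regular_epi_ext cc); apply: (pb_ext pb); cat.
move=> [Z projZ] [X projX] [U projU] /= f g.
have [V [p1 [p2 pb]]] := pullbacks f g.
have projV := pullback_of_projectives KP projZ projU projX pb.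
exists (exist _ V projV), p1, p2.
by split=> [|Q q1 q2]; [apply: pb.1 | apply: pb.2].
Qed.

(** Only the test stages are restricted to [P], so that the notion also applies to objects of [E]
    outside the subcategory. *)
Definition P_weak_pullback X Y Z (f : Hom X Z) (g : Hom Y Z)
    V (p1 : Hom V X) (p2 : Hom V Y) : Prop :=
  f ∘ p1 = g ∘ p2 /\
  forall Q (q1 : Hom Q X) (q2 : Hom Q Y), P Q -> f ∘ q1 = g ∘ q2 ->
    exists u : Hom Q V, p1 ∘ u = q1 /\ p2 ∘ u = q2.

Lemma full_weak_pullback (X Y Z V : full_subcategory P) (f : Hom X Z)
    (g : Hom Y Z) (p1 : Hom V X) (p2 : Hom V Y) :
  is_weak_pullback f g p1 p2 <->
  @P_weak_pullback (sval X) (sval Y) (sval Z) f g (sval V) p1 p2.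
Proof.
split=> -[sq lift]; split=> //.
  by move=> Q q1 q2 PQ; apply: (lift (exist _ Q PQ)).
by move=> [Q PQ] q1 q2; apply: lift.
Qed.

(** Together with its converse [cover_weak_pullback], this identifies weak pullbacks with the
    regular epis onto the pullback in [E]. *)
Lemma weak_pullback_cover X Y Z (f : Hom X Z) (g : Hom Y Z)
    B (b1 : Hom B X) (b2 : Hom B Y) V (p1 : Hom V X) (p2 : Hom V Y) :
  is_pullback f g b1 b2 -> P_weak_pullback f g p1 p2 ->
  exists r : Hom V B, [/\ b1 ∘ r = p1, b2 ∘ r = p2 & P_lifting r].
Proof.
move=> pb [sq lift]; have [r [r1 r2]] := pb_lift pb sq; exists r; split=> //.
move=> D f' PD; have sqB := pb.1.
have [|u [u1 u2]] := lift D (b1 ∘ f') (b2 ∘ f') PD; first by cat.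
by exists u; apply: (pb_ext pb); cat.
Qed.

Lemma cover_weak_pullback X Y Z (f : Hom X Z) (g : Hom Y Z)
    B (b1 : Hom B X) (b2 : Hom B Y) V (r : Hom V B) :
  is_pullback f g b1 b2 -> P_lifting r ->
  P_weak_pullback f g (b1 ∘ r) (b2 ∘ r).
Proof.
move=> pb lift; have sq := pb.1; split; first by cat.
move=> Q q1 q2 PQ /(pb_lift pb) [u [u1 u2]].
by have [v vE] := lift Q u PQ; exists v; split; cat.
Qed.

(** An idempotent determined by projections descends along the cover [r] of the pullback to a
    section of [r]; conversely a section [s] gives the idempotent [s ∘ r]. *)
Lemma idempotents_iff :
  weak_pullbacks_have_idempotents (full_subcategory P) <->
  P_pullbacks_projective.
Proof.
split=> [idem Z U X f g B b1 b2 PZ PU PX pb|KP].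
  have [V [r [PV rr]]] := P_cover B.
  have lr := regular_epi_lifting rr.
  pose ob A (PA : P A) : full_subcategory P := exist _ A PA.
  have := @idem (ob Z PZ) (ob U PU) (ob X PX) f g (ob V PV) (b1 ∘ r) (b2 ∘ r).
  case=> [|i [_ det]].
    by apply/full_weak_pullback; apply: cover_weak_pullback pb lr.
  rewrite /= in i det * => i1 i2.
  have [|s sE] := lifting_desc (t := i) lr.
    by move=> D h k PD e; apply: (det (ob D PD)); rewrite /=; cat.
  apply: (@retract_projective _ _ _ s r _ (P_projective PV)).
  apply: (regular_epi_ext rr); rewrite -compA sE comp_id1l.
  by apply: (pb_ext pb); cat.
move=> [Z PZ] [U PU] [X PX] /= f g [V PV] /= p1 p2 /full_weak_pullback /= wpb.
have [B [b1 [b2 pb]]] := pullbacks f g.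
have projB := KP _ _ _ _ _ _ _ _ PZ PU PX pb.
have [r [r1 r2 lr]] := weak_pullback_cover pb wpb.
have [s rs] := projective_lift (id1 B) projB (lifting_regular_epi lr).
exists (s ∘ r : Hom V V); split=> /=.
- by cat.
- move=> D h k /= e1 e2; suff : r ∘ h = r ∘ k by cat.
  by apply: (pb_ext pb); cat.
- by cat.
- by cat.
Qed.

(** * Products, regular epis and projectives in slices *)

Lemma slice_sval U (A B : slice U) (h k : Hom A B) : h = k -> sval h = sval k.
Proof. by move=> ->. Qed.

Lemma slice_product U (A B Q : slice U) (p1 : Hom Q A) (p2 : Hom Q B) :
  is_product p1 p2 <->
  is_pullback (projT2 A) (projT2 B) (sval p1) (sval p2).
Proof.
have sq1 := proj2_sig p1; have sq2 := proj2_sig p2.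
split=> [prod|pb].
  split=> [|T q1 q2 sq]; first by rewrite /= in sq1 sq2; cat.
  pose T' : slice U := existT _ T (projT2 A ∘ q1).
  pose q1' : Hom T' A := exist _ q1 erefl.
  pose q2' : Hom T' B := exist _ q2 (esym sq).
  have [[u uU] [[/= u1 u2] uniq]] := prod T' q1' q2'.
  exists u; split; first by split; [have := slice_sval u1 | have := slice_sval u2].
  move=> v [v1 v2].
  have vU : projT2 Q ∘ v = projT2 T' by rewrite /= -v1 compA sq1.
  suff uv : exist _ u uU = (exist _ v vU : Hom T' Q) by exact: slice_sval uv.
  by apply: uniq; split; apply: slice_hom_eq.
move=> T q1 q2.
have sq1' := proj2_sig q1; have sq2' := proj2_sig q2; rewrite /= in sq1' sq2'.
have [u [[u1 u2] uniq]] := pb.2 _ (sval q1) (sval q2) (etrans sq1' (esym sq2')).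
have uU : projT2 Q ∘ u = projT2 T by rewrite -sq1 -compA u1.
exists (exist _ u uU); split; first by split; apply: slice_hom_eq.
move=> v [v1 v2]; apply: slice_hom_eq; apply: uniq.
by split; [rewrite -v1 | rewrite -v2].
Qed.

(** From left to right, the image of [sval r] in [E] lies over [U], and the universal property of
    the coequaliser [r] gives a section of its monic part [m]; elements therefore lift along [r]
    because they lift along [q]. *)
Lemma slice_regular_epi U (A B : slice U) (r : Hom A B) :
  regular_epi r <-> regular_epi (sval r).
Proof.
have rU := proj2_sig r; rewrite /= in rU.
split=> [[K [k1 [k2 ce]]]|rr].
  have [I [q [m [qq mono mq]]]] := image (sval r).
  have mqU : projT2 B ∘ m ∘ q = projT2 A by cat.
  pose I' : slice U := existT _ I (projT2 B ∘ m).
  pose q' : Hom A I' := exist _ q mqU.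
  pose m' : Hom I' B := exist _ m erefl.
  have mq' : m' ∘ q' = r by apply: slice_hom_eq.
  have [n mn] : exists n : Hom (projT1 B) I, m ∘ n = id1 (projT1 B).
    have [|n nr] := coeq_desc ce (t := q').
      apply: slice_hom_eq; apply: mono; have := slice_sval ce.1 => /= e.
      by cat.
    exists (sval n); suff: m' ∘ n = id1 B by apply: slice_sval.
    by apply: (coeq_ext ce); cat.
  apply: lifting_regular_epi => D f PD.
  by have [x xE] := regular_epi_lifting qq (n ∘ f) PD; exists x; cat.
have [K [k1 [k2 ce]]] := rr.
pose K' : slice U := existT _ K (projT2 A ∘ k1).
have e2 : projT2 A ∘ k2 = projT2 A ∘ k1 by have := ce.1; cat.
exists K', (exist _ k1 erefl : Hom K' A), (exist _ k2 e2 : Hom K' A).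
split=> [|T t e]; first by apply: slice_hom_eq; apply: ce.1.
have tU := proj2_sig t; rewrite /= in tU.
have [u uE] := coeq_desc ce (slice_sval e).
have uU : projT2 T ∘ u = projT2 B by apply: (regular_epi_ext rr); cat.
exists (exist _ u uU); split; first exact: slice_hom_eq.
move=> v vE; apply: slice_hom_eq; apply: (regular_epi_ext rr).
by rewrite /= uE -vE.
Qed.

Lemma slice_projective U (Q : slice U) : projective Q <-> projective (projT1 Q).
Proof.
split=> [projQ|projQ A B r rr f].
  have [X [r [PX rr]]] := P_cover (projT1 Q).
  pose X' : slice U := existT _ X (projT2 Q ∘ r).
  pose r' : Hom X' Q := exist _ r erefl.
  have rr' : regular_epi r' by apply/slice_regular_epi.
  have [s rs] := projective_lift (id1 Q) projQ rr'.
  exact: retract_projective (slice_sval rs) (P_projective PX).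
move/slice_regular_epi in rr.
have [g gE] := projective_lift (sval f) projQ rr.
have fU := proj2_sig f; have rU := proj2_sig r; rewrite /= in fU rU.
have gU : projT2 A ∘ g = projT2 Q by cat.
by exists (exist _ g gU); apply: slice_hom_eq.
Qed.

Lemma slice_products U : has_binary_products (slice U).
Proof.
move=> A B; have [V [v1 [v2 pb]]] := pullbacks (projT2 A) (projT2 B).
pose Q : slice U := existT _ V (projT2 A ∘ v1).
exists Q, (exist _ v1 erefl : Hom Q A), (exist _ v2 (esym pb.1) : Hom Q B).
by apply/slice_product.
Qed.

(** From left to right, internal projectivity of [X'] is applied to a cover of the product [V'] and
    the identity of [V']. The resulting cover of [Z'] splits, so [V] is a retract of an object of
    [P]. Conversely, covering the test object by an object of [P] makes its product with [Q]
    projective. *)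
Lemma slice_internally_projective_iff :
  slice_projectives_internally_projective P <-> P_pullbacks_projective.
Proof.
split=> [int Z U X f g V p1 p2 PZ PU PX pb|KP [U PU] /= Q projQ X A B r rr].
  pose Z' : slice U := existT _ Z f; pose X' : slice U := existT _ X g.
  pose V' : slice U := existT _ V (f ∘ p1).
  pose p1' : Hom V' Z' := exist _ p1 erefl.
  pose p2' : Hom V' X' := exist _ p2 (esym pb.1).
  have prod : is_product p1' p2' by apply/slice_product.
  have projX : projective X' by apply/slice_projective/P_projective.
  have projZ : projective Z' by apply/slice_projective/P_projective.
  have [A [r [PA rr]]] := P_cover V.
  pose A' : slice U := existT _ A (f ∘ p1 ∘ r).
  pose r' : Hom A' V' := exist _ r erefl.
  have rr' : regular_epi r' by apply/slice_regular_epi.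
  have := int (exist _ U PU) X' projX Z' A' V' r' rr' V' p1' p2' prod (id1 V').
  case=> T [t [tt [TP [t1 [t2 [prodT [u [[u1 u2] [f' f'E]]]]]]]]].
  have [s ts] := projective_lift (id1 Z') projZ tt.
  have [w [[w1 w2] _]] := prodT V' (s ∘ p1') p2'.
  apply: (@retract_projective _ _ _ (sval (f' ∘ w)) r _ (P_projective PA)).
  suff e : r' ∘ (f' ∘ w) = id1 V' by exact: slice_sval e.
  rewrite comp_id1l in f'E; rewrite compA f'E.
  have [x [_ uniq]] := prod V' p1' p2'.
  rewrite -(uniq (u ∘ w)) ?(uniq (id1 V')) ?comp_id1r //; split=> //.
    by rewrite compA u1 -compA w1 compA ts comp_id1l.
  by rewrite compA u2.
move=> XP x1 x2 prod f.
have [T0 [t0 [PT tt]]] := P_cover (projT1 X).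
pose T : slice U := existT _ T0 (projT2 X ∘ t0).
pose t : Hom T X := exist _ t0 erefl.
exists T, t; split; first by apply/slice_regular_epi.
have [TP [t1 [t2 prodT]]] := slice_products T Q.
exists TP, t1, t2; split=> //.
have [u [uP _]] := prod TP (t ∘ t1) t2; exists u; split=> //.
suff projTP : projective TP by have := projTP _ _ r rr (f ∘ u).
apply/slice_projective; move/slice_product: prodT => prodT.
apply: (pullback_of_projectives KP _ _ _ prodT).
- exact: P_projective.
- exact: P_projective.
- exact/slice_projective.
Qed.

(** * Weak dependent products from exponentials *)

(* [e] is a family of maps from the fibres of [f] to [Y] indexed by [W].  With
   [psi] an identity this is a weak dependent product of [phi] along [f], and
   with [psi = f] a weak exponential in the slice over [Z]. *)
Definition weakly_universal X Z Y M
    (f : Hom X Z) (phi : Hom Y M) (psi : Hom X M)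
    W (w : Hom W Z) V (p1 : Hom V X) (p2 : Hom V W) (e : Hom V Y) : Prop :=
  [/\ is_pullback f w p1 p2, phi ∘ e = psi ∘ p1 &
      forall W' (w' : Hom W' Z) V' (p1' : Hom V' X) (p2' : Hom V' W')
        (e' : Hom V' Y),
      P W' -> is_pullback f w' p1' p2' -> phi ∘ e' = psi ∘ p1' ->
      exists2 h : Hom W' W, w ∘ h = w' &
        forall D (v : Hom D V) (v' : Hom D V'), P D ->
        p1 ∘ v = p1' ∘ v' -> p2 ∘ v = h ∘ p2' ∘ v' -> e ∘ v = e' ∘ v'].

Definition P_weak_dependent_products : Prop :=
  forall Y X Z (g : Hom Y X) (f : Hom X Z), P Y -> P X -> P Z ->
  exists W (w : Hom W Z) V (p1 : Hom V X) (p2 : Hom V W) (e : Hom V Y),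
    P W /\ weakly_universal f g (id1 X) w p1 p2 e.

(** An arrow determined by projections out of a weak pullback is an arrow out of the pullback in [E]
    that it covers, so the two kinds of data can be exchanged. *)
Lemma weak_dependent_products_iff :
  has_weak_dependent_products (full_subcategory P) <->
  P_weak_dependent_products.
Proof.
pose ob A (PA : P A) : full_subcategory P := exist _ A PA.
split=> [wdp Y X Z g f PY PX PZ|wdp [Y PY] [X PX] [Z PZ] /= g f].
  have [D univ] := @wdp (ob Y PY) (ob X PX) (ob Z PZ) g f.
  case: D univ => -[W PW] /= w [V0 PV0] /= v1 v2 wpb e0 det over univ.
  have wpbE : @P_weak_pullback X W Z f w V0 v1 v2 :=
    (@full_weak_pullback (ob X PX) (ob W PW) (ob Z PZ) (ob V0 PV0) f w v1 v2).1 wpb.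
  have [V [p1 [p2 pb]]] := pullbacks f w.
  have [r [r1 r2 lr]] := weak_pullback_cover pb wpbE.
  have [|e eE] := lifting_desc (t := e0) lr.
    move=> D h k PD rhk; have detD := det (ob D PD) h k; rewrite /= in detD.
    by apply: detD; cat.
  have overE : g ∘ e0 = v1 := over.
  exists W, w, V, p1, p2, e; split=> //; split=> //.
    by apply: (lifting_ext lr); cat.
  move=> W' w' V' p1' p2' e' PW' pb' over1.
  have [X0 [c [PX0 cc]]] := P_cover V'.
  have wpb' := cover_weak_pullback pb' (regular_epi_lifting cc).
  have wpb0 : @is_weak_pullback (full_subcategory P) (ob X PX) (ob W' PW')
      (ob Z PZ) f w' (ob X0 PX0) (p1' ∘ c) (p2' ∘ c).
    exact/full_weak_pullback.
  have det0 : @determined_by_projections (full_subcategory P) (ob X PX)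
      (ob W' PW') (ob X0 PX0) (p1' ∘ c) (p2' ∘ c) (ob Y PY) (e' ∘ c).
    move=> D h k /= e1 e2; suff : c ∘ h = c ∘ k by cat.
    by apply: (pb_ext pb'); cat.
  have over0 : g ∘ (e' ∘ c) = p1' ∘ c by cat.
  have [h [k [hE k1 k2 ke]]] : exists (h : Hom W' W) (k : Hom X0 V0),
      [/\ w ∘ h = w', v1 ∘ k = p1' ∘ c, v2 ∘ k = h ∘ (p2' ∘ c) &
          e0 ∘ k = e' ∘ c].
    exact: univ (@DepProdData (full_subcategory P) (ob Y PY) (ob X PX)
      (ob Z PZ) g f (ob W' PW') w' (ob X0 PX0) _ _ wpb0 _ det0 over0).
  exists h => // D v v' PD e1 e2.
  have [x xE] := regular_epi_lifting cc v' PD.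
  have -> : v = r ∘ (k ∘ x) by apply: (pb_ext pb); cat.
  by cat.
have [W [w [V [p1 [p2 [e [PW [pb over univ]]]]]]]] := wdp Y X Z g f PY PX PZ.
have [V0 [c [PV0 cc]]] := P_cover V; have lc := regular_epi_lifting cc.
have wpb : @is_weak_pullback (full_subcategory P) (ob X PX) (ob W PW)
    (ob Z PZ) f w (ob V0 PV0) (p1 ∘ c) (p2 ∘ c).
  by apply/full_weak_pullback; apply: cover_weak_pullback pb lc.
have det : @determined_by_projections (full_subcategory P) (ob X PX) (ob W PW)
    (ob V0 PV0) (p1 ∘ c) (p2 ∘ c) (ob Y PY) (e ∘ c).
  move=> D h k /= e1 e2; suff : c ∘ h = c ∘ k by cat.
  by apply: (pb_ext pb); cat.
have overc : g ∘ (e ∘ c) = p1 ∘ c by cat.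
exists (@DepProdData (full_subcategory P) (ob Y PY) (ob X PX) (ob Z PZ)
  g f (ob W PW) w (ob V0 PV0) (p1 ∘ c) (p2 ∘ c) wpb (e ∘ c) det overc).
case=> -[W' PW'] /= w' [V0' PV0'] /= v1 v2 wpb' e0 det' over'.
have wpbE' : @P_weak_pullback X W' Z f w' V0' v1 v2 :=
  (@full_weak_pullback (ob X PX) (ob W' PW') (ob Z PZ) (ob V0' PV0') f w' v1 v2).1 wpb'.
have [V' [p1' [p2' pb']]] := pullbacks f w'.
have [r [r1 r2 lr]] := weak_pullback_cover pb' wpbE'.
have [|e' eE'] := lifting_desc (t := e0) lr.
  move=> D h k PD rhk; have detD := det' (ob D PD) h k; rewrite /= in detD.
  by apply: detD; cat.
have overE : g ∘ e0 = v1 := over'.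
have [|h hE comp] := univ W' w' V' p1' p2' e' PW' pb'.
  by apply: (lifting_ext lr); cat.
have sq' := pb'.1.
have [|u [u1 u2]] := pb_lift pb (q1 := p1' ∘ r) (q2 := h ∘ p2' ∘ r).
  by cat.
have [k kE] := lc V0' u PV0'.
exists h, k; split=> //=; try by cat.
by rewrite -compA kE (comp V0' u r PV0') //; cat.
Qed.

(** * Exponentials in slices, expressed in the base category *)

Lemma slice_terminal U : has_terminal (slice U).
Proof.
pose I : slice U := existT (Hom^~ U) U (id1 U); exists I => A.
exists (exist _ (projT2 A) (comp_id1l (projT2 A)) : Hom A I); split=> // u _.
by apply: slice_hom_eq; rewrite /= -[RHS]comp_id1l; apply/esym/(proj2_sig u).
Qed.

(** The exponential of [b] by [a] in the slice over [U], with existence and uniqueness of transposes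
    as separate clauses. *)
Definition is_slice_exponential U A B (a : Hom A U) (b : Hom B U)
    F (phi : Hom F U) FA (x1 : Hom FA F) (x2 : Hom FA A) (ev : Hom FA B) : Prop :=
  [/\ is_pullback phi a x1 x2, b ∘ ev = a ∘ x2,
      forall T (t : Hom T U) TA (t1 : Hom TA T) (t2 : Hom TA A) (f : Hom TA B),
        is_pullback t a t1 t2 -> b ∘ f = a ∘ t2 ->
        exists (g : Hom T F) (u : Hom TA FA),
          [/\ phi ∘ g = t, x1 ∘ u = g ∘ t1, x2 ∘ u = t2 & ev ∘ u = f] &
      forall T TA (t1 : Hom TA T) (t2 : Hom TA A) (g g' : Hom T F)
        (u u' : Hom TA FA),
        is_pullback (phi ∘ g) a t1 t2 -> phi ∘ g = phi ∘ g' ->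
        x1 ∘ u = g ∘ t1 -> x2 ∘ u = t2 -> x1 ∘ u' = g' ∘ t1 -> x2 ∘ u' = t2 ->
        ev ∘ u = ev ∘ u' -> g = g'].

Lemma locally_cartesian_closed_iff :
  locally_cartesian_closed E <->
  forall U A B (a : Hom A U) (b : Hom B U),
    exists F (phi : Hom F U) FA (x1 : Hom FA F) (x2 : Hom FA A) (ev : Hom FA B),
      is_slice_exponential a b phi x1 x2 ev.
Proof.
split=> [lcc U A B a b|exps U]; last first.
  split; [exact: slice_terminal | exact: slice_products | move=> A B].
  have [F [phi [FA [x1 [x2 [ev [pb evU ex uniq]]]]]]] :=
    exps U (projT1 A) (projT1 B) (projT2 A) (projT2 B).
  pose F' : slice U := existT _ F phi.
  pose FA' : slice U := existT _ FA (phi ∘ x1).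
  have sq := pb.1.
  have evU' : projT2 B ∘ ev = phi ∘ x1 by rewrite evU sq.
  pose x1' : Hom FA' F' := exist _ x1 erefl.
  pose x2' : Hom FA' A := exist _ x2 (esym sq).
  pose ev' : Hom FA' B := exist _ ev evU'.
  exists F', FA', x1', x2', ev'; split; first exact/slice_product.
  move=> T TA t1 t2 /slice_product pbT f.
  have fU := proj2_sig f; have t2U := proj2_sig t2; have t1U := proj2_sig t1.
  rewrite /= in fU t1U t2U.
  have [|g [u [gU u1 u2 uf]]] := ex _ _ _ _ _ (sval f) pbT.
    by rewrite fU t2U.
  have uU : phi ∘ x1 ∘ u = projT2 TA by cat.
  exists (exist _ g gU); split.
    exists (exist _ u uU : Hom TA FA').
    by split; [split|]; apply: slice_hom_eq.
  move=> g' [u' [[/slice_sval /= u1' /slice_sval /= u2'] /slice_sval /= uf']].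
  have gU' : phi ∘ sval g' = projT2 T := proj2_sig g'.
  apply: slice_hom_eq => /=.
  apply: (uniq _ _ (sval t1) (sval t2) g (sval g') u (sval u')) => //.
  - by rewrite gU.
  - by rewrite gU gU'.
  - by rewrite uf uf'.
have [_ _ exps] := lcc U.
pose A' : slice U := existT _ A a; pose B' : slice U := existT _ B b.
have [[F phi] [FA [x1 [x2 [ev [prod univ]]]]]] := exps A' B'.
have evU := proj2_sig ev; have x2U := proj2_sig x2; rewrite /= in evU x2U.
exists F, phi, (projT1 FA), (sval x1), (sval x2), (sval ev).
have tr T (t : Hom T U) TA (t1 : Hom TA T) (t2 : Hom TA A) (f : Hom TA B) :
  is_pullback t a t1 t2 -> b ∘ f = a ∘ t2 ->
  (exists (g : Hom T F) (u : Hom TA (projT1 FA)),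
    [/\ phi ∘ g = t, sval x1 ∘ u = g ∘ t1, sval x2 ∘ u = t2 & sval ev ∘ u = f]) /\
  (forall (g g' : Hom T F) (u u' : Hom TA (projT1 FA)),
    phi ∘ g = t -> phi ∘ g' = t ->
    sval x1 ∘ u = g ∘ t1 -> sval x2 ∘ u = t2 -> sval ev ∘ u = f ->
    sval x1 ∘ u' = g' ∘ t1 -> sval x2 ∘ u' = t2 -> sval ev ∘ u' = f -> g = g').
  move=> pb fU; have sq := pb.1.
  pose T' : slice U := existT _ T t; pose TA' : slice U := existT _ TA (t ∘ t1).
  pose t1' : Hom TA' T' := exist _ t1 erefl.
  pose t2' : Hom TA' A' := exist _ t2 (esym sq).
  have fU' : b ∘ f = t ∘ t1 by rewrite fU sq.
  pose f' : Hom TA' B' := exist _ f fU'.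
  have prodT : is_product t1' t2' by apply/slice_product.
  have [g [[u [[u1 u2] uf]] uniq]] := univ T' TA' t1' t2' prodT f'.
  split.
    exists (sval g), (sval u).
    by split; [apply: (proj2_sig g)|move/slice_sval: u1|move/slice_sval: u2|
      move/slice_sval: uf].
  have toE (k : Hom T F) (v : Hom TA (projT1 FA)) : phi ∘ k = t ->
    sval x1 ∘ v = k ∘ t1 -> sval x2 ∘ v = t2 -> sval ev ∘ v = f -> sval g = k.
    move=> kU v1 v2 vf.
    have vU : projT2 FA ∘ v = t ∘ t1 by rewrite -x2U -compA v2 sq.
    suff -> : g = (exist _ k kU : Hom T' (existT _ F phi)) by [].
    apply: uniq; exists (exist _ v vU : Hom TA' FA).
    by split; [split|]; apply: slice_hom_eq.
  move=> k k' v v' kU kU' v1 v2 vf v1' v2' vf'.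
  by rewrite -(toE k v) // (toE k' v').
split.
- by move/slice_product: prod.
- by rewrite evU x2U.
- by move=> T t TA t1 t2 f pb fU; apply: (tr _ _ _ _ _ _ pb fU).1.
move=> T TA t1 t2 g g' u u' pb e u1 u2 u1' u2' eu.
have fU : b ∘ (sval ev ∘ u) = a ∘ t2 by rewrite compA evU -u2 compA x2U.
exact: (tr _ _ _ _ _ _ pb fU).2 g g' u u' erefl (esym e) u1 u2 erefl u1' u2' (esym eu).
Qed.

Lemma weak_dependent_products_of_slice_exponentials :
  locally_cartesian_closed E -> P_weak_dependent_products.
Proof.
move/locally_cartesian_closed_iff=> exps Y X Z g f PY PX PZ.
(* Over a point of [Z], [F] holds the maps from the fibre of [f] to that of [f ∘ g], and [G] those
   from the fibre of [f] to itself. *)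
have [F [phi [FX [x1 [x2 [ev [pb evU ex _]]]]]]] := exps _ _ _ f (f ∘ g).
have [G [gam [GX [y1 [y2 [ev' [pb' evU' ex' uniq]]]]]]] := exps _ _ _ f f.
(* [g1] composes a map with [g] and [g2] is constantly the identity, so their equaliser [S] consists
   of the sections of [g]. *)
have [|g1 [u1 [g1U u11 u12 ev1]]] := ex' _ _ _ _ _ (g ∘ ev) pb; first by cat.
have [|g2 [u2 [g2U u21 u22 ev2]]] := ex' _ _ _ _ _ x2 pb; first by [].
have [S [i [iE monoi lifti]]] :=
  finite_limits_equalisers (exact_finite_limits exactE) g1 g2.
have [W [n [PW nn]]] := P_cover S.
pose w := phi ∘ i ∘ n; have wE : w = phi ∘ i ∘ n by [].
have [V [p1 [p2 pbV]]] := pullbacks f w.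
have sqV := pbV.1.
have [|j [j1 j2]] := pb_lift pb (q1 := i ∘ n ∘ p2) (q2 := p1); first by cat.
(* Followed by [ev'], this equation reads [g ∘ ev ∘ j = p1]. *)
have u12j : u1 ∘ j = u2 ∘ j by apply: (pb_ext pb'); cat.
exists W, w, V, p1, p2, (ev ∘ j); split=> //; split=> //; first by cat.
move=> W' w' V' p1' p2' e' PW' pbV' over.
have pbT := pb_sym pbV'.
have [|k [u [kU uu1 uu2 uev]]] := ex _ _ _ _ _ e' pbT; first by cat.
have k12 : g1 ∘ k = g2 ∘ k.
  by apply: (uniq _ _ p2' p1' _ _ (u1 ∘ u) (u2 ∘ u)); cat.
have [k' k'E] := lifti _ _ k12.
have [h hE] := regular_epi_lifting nn k' PW'.
exists h; first by cat.
move=> D v v' PD e1 e2; have jv : j ∘ v = u ∘ v' by apply: (pb_ext pb); cat.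
by cat.
Qed.

(** * Exponentials from weak dependent products *)

Section FromWeakDependentProducts.
Hypotheses (KP : P_pullbacks_projective) (wdp : P_weak_dependent_products).

(** The required families are sections of the pullback of [phi] along [psi], so a weak dependent
    product of a cover [Y0] of that pullback serves: by [KP] each [V'] is projective, and families
    on it lift to [Y0]. *)
Lemma weakly_universal_P X Z Y M (f : Hom X Z) (phi : Hom Y M) (psi : Hom X M) :
  P X -> P Z ->
  exists W (w : Hom W Z) V (p1 : Hom V X) (p2 : Hom V W) (e : Hom V Y),
    weakly_universal f phi psi w p1 p2 e.
Proof.
move=> PX PZ; have [B [b1 [b2 pbB]]] := pullbacks psi phi.
have sqB := pbB.1.
have [Y0 [c [PY0 cc]]] := P_cover B.
have [W [w [V [p1 [p2 [e [PW [pb over univ]]]]]]]] :=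
  wdp (b1 ∘ c) f PY0 PX PZ.
exists W, w, V, p1, p2, (b2 ∘ c ∘ e); split=> //; first by cat.
move=> W' w' V' p1' p2' e' PW' pb' over'.
have projV' := KP PX PZ PW' pb'.
have [u [u1 u2]] := pb_lift pbB (esym over').
have [u' u'E] := projective_lift u projV' cc.
have [|h hE comp] := univ W' w' V' p1' p2' u' PW' pb'; first by cat.
exists h => // D v v' PD e1 e2; have := comp D v v' PD e1 e2; cat.
Qed.

(* Universal quantification of the equation [e1 = e2] along [f]. *)
Lemma forall_equaliser U A B (f : Hom A U) (e1 e2 : Hom A B) :
  exists R (m : Hom R U),
    [/\ monic m,
        forall D (x : Hom D A) (y : Hom D R), P D ->
          f ∘ x = m ∘ y -> e1 ∘ x = e2 ∘ x &
        forall T (t : Hom T U),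
          (forall D (x : Hom D A) (y : Hom D T), P D ->
             f ∘ x = t ∘ y -> e1 ∘ x = e2 ∘ x) ->
          exists y : Hom T R, m ∘ y = t].
Proof.
have [U0 [p [PU0 pp]]] := P_cover U.
have [AU [q1 [q2 pbA]]] := pullbacks f p; have sqA := pbA.1.
have [A0 [c [PA0 cc]]] := P_cover AU.
have [S [i [iE monoi lifti]]] := finite_limits_equalisers
  (exact_finite_limits exactE) (e1 ∘ q1 ∘ c) (e2 ∘ q1 ∘ c).
(* As [i] is monic, a point of [U0] carries at most one family of lifts along [i], and it carries
   one precisely when the equation holds on the fibre. *)
have [W [w [V [p1 [p2 [e [pb over univ]]]]]]] :=
  weakly_universal_P (q2 ∘ c) i (id1 A0) PA0 PU0.
(* [W] may name one family many times, and [U0] may cover a point of [U] many times; the image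
   leaves a subobject of [U]. *)
have [R [n [m [nn mono mn]]]] := image (p ∘ w).
exists R, m; split=> // [D x y PD xy|T t agree].
  have [y' y'E] := regular_epi_lifting nn y PD.
  have [|z [z1 z2]] := pb_lift pbA (q1 := x) (q2 := w ∘ y'); first by cat.
  have [x0 x0E] := regular_epi_lifting cc z PD.
  by have [|v [v1 v2]] := pb_lift pb (q1 := x0) (q2 := y'); cat.
apply: monic_factor => // D y PD.
have [t0 t0E] := regular_epi_lifting pp (t ∘ y) PD.
have [V' [p1' [p2' pb']]] := pullbacks (q2 ∘ c) t0; have sq' := pb'.1.
have [|e' e'E] := lifti _ p1'.
  apply: P_ext => D' v PD'.
  have := agree D' (q1 ∘ c ∘ p1' ∘ v) (y ∘ p2' ∘ v) PD'.
  by rewrite !compA; apply; cat.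
have [|h hE _] := univ D t0 V' p1' p2' e' PD pb'; first by cat.
by exists (n ∘ h); cat.
Qed.

(** Covers replace [U] and the fibres of [a] by objects of [P], which yields families on [A0];
    universal quantification cuts out those that descend to the fibres of [a]. *)
Lemma weak_slice_exponential U A B (a : Hom A U) (b : Hom B U) :
  exists W (w : Hom W U) V (p1 : Hom V A) (p2 : Hom V W) (e : Hom V B),
    weakly_universal a b a w p1 p2 e.
Proof.
have [U0 [p [PU0 pp]]] := P_cover U.
have [AU [q1 [q2 pbA]]] := pullbacks a p; have sqA := pbA.1.
have [A0 [c [PA0 cc]]] := P_cover AU.
have [W0 [w0 [V0 [v1 [v2 [e0 [pb0 over0 univ0]]]]]]] :=
  weakly_universal_P (q2 ∘ c) b (a ∘ q1 ∘ c) PA0 PU0.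
have sq0 := pb0.1.
have [V1 [s1 [s2 pb1]]] := pullbacks a (p ∘ w0).
(* [r] sends an argument in [A0] to the argument in [A] that it covers; [R] consists of the families
   that agree on the kernel pair of [r]. *)
have [|r [r1 r2]] := pb_lift pb1 (q1 := q1 ∘ c ∘ v1) (q2 := v2); first by cat.
have [K [d1 [d2 pbK]]] := pullbacks r r; have sqK := pbK.1.
have [R [m [mono agree univR]]] :=
  forall_equaliser (v2 ∘ d1) (e0 ∘ d1) (e0 ∘ d2).
pose w := p ∘ w0 ∘ m; have wE : w = p ∘ w0 ∘ m by [].
have [V [p1 [p2 pb]]] := pullbacks a w; have sq := pb.1.
(* Graph of evaluation: lift the argument to [V0] and apply [e0]; membership in [R] removes the
   dependence on the lift. *)
pose F D (v : Hom D V) (z : Hom D B) := exists x : Hom D V0,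
  [/\ q1 ∘ c ∘ v1 ∘ x = p1 ∘ v, v2 ∘ x = m ∘ p2 ∘ v & e0 ∘ x = z].
have [D D' k v z _ _ [x [x1 x2 <-]]|D v PD|D v z z' PD|e eP] :=
  @hom_of_P_elements V B F.
- by exists (x ∘ k); split; cat.
- have [|y [y1 y2]] := pb_lift pbA (q1 := p1 ∘ v) (q2 := w0 ∘ m ∘ p2 ∘ v).
    by cat.
  have [x0 x0E] := regular_epi_lifting cc y PD.
  have [|x [x1 x2]] := pb_lift pb0 (q1 := x0) (q2 := m ∘ p2 ∘ v); first by cat.
  by exists (e0 ∘ x), x; split; cat.
- move=> [x [x1 x2 <-]] [x' [x1' x2' <-]].
  have rx : r ∘ x = r ∘ x' by apply: (pb_ext pb1); cat.
  have [k [k1 k2]] := pb_lift pbK rx.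
  have := agree D k (p2 ∘ v) PD; rewrite -!compA k1 k2; apply; cat.
exists R, w, V, p1, p2, e; split=> //.
  by apply: P_ext => D v PD; have [x [x1 x2 xe]] := eP D v PD; cat.
move=> W' w' V' p1' p2' e' PW' pb' over'; have sq' := pb'.1.
have [t tE] := regular_epi_lifting pp w' PW'.
have [V'' [p1'' [p2'' pb'']]] := pullbacks (q2 ∘ c) t; have sq'' := pb''.1.
have [|j [j1 j2]] := pb_lift pb' (q1 := q1 ∘ c ∘ p1'') (q2 := p2'').
  by cat.
have [|h hE comp] := univ0 W' t V'' p1'' p2'' (e' ∘ j) PW' pb''.
  by cat.
(* The family named by [h] is [e'] read through the cover, so it takes equal values at two lifts of
   one argument and [h] factors through [R]. *)
have eval D (x : Hom D V0) (y : Hom D W') (z : Hom D V') : P D ->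
    v2 ∘ x = h ∘ y -> p1' ∘ z = q1 ∘ c ∘ v1 ∘ x -> p2' ∘ z = y ->
    e0 ∘ x = e' ∘ z.
  move=> PD xy z1 z2.
  have [|u [u1 u2]] := pb_lift pb'' (q1 := v1 ∘ x) (q2 := y); first by cat.
  rewrite (comp D x u PD) //; last by cat.
  suff : j ∘ u = z by cat.
  by apply: (pb_ext pb'); cat.
have [|h' h'E] := univR W' h.
  move=> D k y PD xy.
  have [|z [z1 z2]] :=
    pb_lift pb' (q1 := q1 ∘ c ∘ v1 ∘ d1 ∘ k) (q2 := y); first by cat.
  rewrite -!compA (eval D (d1 ∘ k) y z) ?(eval D (d2 ∘ k) y z) //; by cat.
exists h'; first by cat.
move=> D v v' PD z1 z2; have [x [x1 x2 <-]] := eP D v PD.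
by apply: (eval D x (p2' ∘ v')); cat.
Qed.

(** Extensional equality is divided out of a weak exponential; effectivity turns equality in the
    quotient back into extensional equality, which makes transposes unique. *)
Lemma slice_exponential U A B (a : Hom A U) (b : Hom B U) :
  exists F (phi : Hom F U) FA (x1 : Hom FA F) (x2 : Hom FA A) (ev : Hom FA B),
    is_slice_exponential a b phi x1 x2 ev.
Proof.
have [W [w [V [p1 [p2 [e [pb over univ]]]]]]] := weak_slice_exponential a b.
have sq := pb.1.
(* Two elements of [W] name the same partial map when they evaluate equally
   over every further stage; this relation is represented by [R]. *)
pose same D (h k : Hom D W) := w ∘ h = w ∘ k /\
  forall D' (y : Hom D' D) (v v' : Hom D' V), P D' -> p1 ∘ v = p1 ∘ v' ->
    p2 ∘ v = h ∘ y -> p2 ∘ v' = k ∘ y -> e ∘ v = e ∘ v'.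
have [R [r1 [r2 [monoR sameR]]]] : exists R (r1 r2 : Hom R W),
    jointly_monic r1 r2 /\ forall D (h k : Hom D W),
      same D h k <-> exists u : Hom D R, r1 ∘ u = h /\ r2 ∘ u = k.
  (* [WW] consists of pairs of names over one point of [U]; [d1] and [d2] attach a common argument
     from [A2] to each of them, and [R] asks for equal values at all arguments. *)
  have [WW [w1 [w2 pbW]]] := pullbacks w w; have sqW := pbW.1.
  have [A2 [a1 [a2 pbA]]] := pullbacks a (w ∘ w1); have sqA := pbA.1.
  have [|d1 [d11 d12]] := pb_lift pb (q1 := a1) (q2 := w1 ∘ a2); first by cat.
  have [|d2 [d21 d22]] := pb_lift pb (q1 := a1) (q2 := w2 ∘ a2); first by cat.
  have [R [m [mono agree univR]]] := forall_equaliser a2 (e ∘ d1) (e ∘ d2).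
  exists R, (w1 ∘ m), (w2 ∘ m); split=> [D h k e1 e2|D h k].
    by apply: mono; apply: (pb_ext pbW); cat.
  split=> [[hk eqv]|[u [<- <-]]].
    have [z [z1 z2]] := pb_lift pbW hk.
    have [|u uE] := univR D z.
      move=> D' x y PD' xy; rewrite -!compA.
      by apply: (eqv D' y) => //; cat.
    by exists u; split; cat.
  split=> [|D' y v v' PD' vv' v2 v2']; first by cat.
  have [|x [e1 e2]] := pb_lift pbA (q1 := p1 ∘ v) (q2 := m ∘ u ∘ y).
    by cat.
  have <- : d1 ∘ x = v by apply: (pb_ext pb); cat.
  have <- : d2 ∘ x = v' by apply: (pb_ext pb); cat.
  by rewrite !compA; apply: (agree D' x (u ∘ y)) => //; cat.
have same_R D (u : Hom D R) : same D (r1 ∘ u) (r2 ∘ u).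
  by apply/sameR; exists u.
have eqr : equivalence_relation r1 r2.
  split=> //.
  - apply/sameR; split=> // D y v v' PD e1 e2 e3.
    by have -> : v = v' by apply: (pb_ext pb); cat.
  - apply/sameR; have [e1 e2] := same_R R (id1 R).
    rewrite !comp_id1r in e1 e2; split=> // D y v v' PD vv' v2 v2'.
    by apply/esym/(e2 D y).
  move=> T q1 q2 pbT; apply/sameR; have sqT := pbT.1.
  have [e1 e2] := same_R T q1; have [e1' e2'] := same_R T q2.
  split=> [|D y v v' PD vv' v2 v2']; first by cat.
  have [|v'' [u1 u2]] := pb_lift pb (q1 := p1 ∘ v) (q2 := r2 ∘ q1 ∘ y).
    by cat.
  by rewrite (e2 D y v v'') ?(e2' D y v'' v') //; cat.
have [F [q [ce pbq]]] := exact_effective exactE eqr.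
have qr := ce.1.
have qq : regular_epi q by exists R, r1, r2.
have lq := regular_epi_lifting qq.
have qP D (h k : Hom D W) : q ∘ h = q ∘ k <-> same D h k.
  split=> [/(pb_lift pbq) uP|/sameR [u [u1 u2]]]; first exact/sameR.
  by cat.
have [|phi phiE] := coeq_desc ce (t := w).
  by have [] := same_R R (id1 R); rewrite !comp_id1r.
have [FA [x1 [x2 pbF]]] := pullbacks phi a; have sqF := pbF.1.
(* Graph of evaluation on [F]: apply [e] to any representative in [V]. By [functG] the value does
   not depend on it. *)
pose G D (v : Hom D FA) (z : Hom D B) := exists v0 : Hom D V,
  [/\ p1 ∘ v0 = x2 ∘ v, q ∘ p2 ∘ v0 = x1 ∘ v & e ∘ v0 = z].
have functG D (v v' : Hom D V) : P D -> p1 ∘ v = p1 ∘ v' ->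
    q ∘ p2 ∘ v = q ∘ p2 ∘ v' -> e ∘ v = e ∘ v'.
  move=> PD e1 e2.
  have [|_ eqv] := (qP D (p2 ∘ v) (p2 ∘ v')).1; first by cat.
  by apply: (eqv D (id1 D)); rewrite ?comp_id1r.
have [D D' k v z _ _ [v0 [v1 v2 <-]]|D v PD|D v z z' PD|ev evP] :=
  @hom_of_P_elements FA B G.
- by exists (v0 ∘ k); split; cat.
- have [k kE] := lq D (x1 ∘ v) PD.
  have [|v0 [v1 v2]] := pb_lift pb (q1 := x2 ∘ v) (q2 := k); first by cat.
  by exists (e ∘ v0), v0; split; cat.
- move=> [v0 [v1 v2 <-]] [v0' [v1' v2' <-]].
  by apply: functG => //; cat.
have evE D (v : Hom D FA) (v0 : Hom D V) : P D ->
    p1 ∘ v0 = x2 ∘ v -> q ∘ p2 ∘ v0 = x1 ∘ v -> ev ∘ v = e ∘ v0.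
  move=> PD e1 e2; have [v1 [e1' e2' <-]] := evP D v PD.
  by apply: functG => //; cat.
exists F, phi, FA, x1, x2, ev; split=> //.
- by apply: P_ext => D v PD; have [v0 [e1 e2 e3]] := evP D v PD; cat.
- move=> T t TA t1 t2 f pbT fU; have sqT := pbT.1.
  (* [k] names the partial map given by [f] over the element [y] of [T]. *)
  pose names D (y : Hom D T) (k : Hom D W) := w ∘ k = t ∘ y /\
    forall D' (l : Hom D' D) (v : Hom D' V) (s : Hom D' TA), P D' ->
      p1 ∘ v = t2 ∘ s -> p2 ∘ v = k ∘ l -> t1 ∘ s = y ∘ l -> e ∘ v = f ∘ s.
  (* Any two names over [y] are related by [same], so the class of a name is a well-defined value
     for [g]. *)
  pose H D (y : Hom D T) (z : Hom D F) := exists2 k, q ∘ k = z & names D y k.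
  have [D D' l y z _ _ [k <- [k1 k2]]|D y PD|D y z z' PD|g gP] :=
    @hom_of_P_elements T F H.
  + exists (k ∘ l); first by rewrite compA.
    split=> [|D'' l' v s PD'' e1 e2 e3]; first by cat.
    by apply: (k2 D'' (l ∘ l')) => //; cat.
  (* A name exists by weak universality, applied to the pullback of [a] along [t ∘ y]. *)
  + have [V' [p1' [p2' pb']]] := pullbacks a (t ∘ y); have sq' := pb'.1.
    have [|j [j1 j2]] := pb_lift pbT (q1 := y ∘ p2') (q2 := p1'); first by cat.
    have [|h hE comp] := univ D (t ∘ y) V' p1' p2' (f ∘ j) PD pb'; first by cat.
    exists (q ∘ h), h => //; split=> // D' l v s PD' e1 e2 e3.
    have [|v' [v1 v2]] := pb_lift pb' (q1 := p1 ∘ v) (q2 := l); first by cat.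
    rewrite (comp D' v v') //; last by cat.
    suff : j ∘ v' = s by cat.
    by apply: (pb_ext pbT); cat.
  + move=> [k <- [k1 k2]] [k' <- [k1' k2']]; apply/qP.
    split=> [|D' l v v' PD' e1 e2 e3]; first by cat.
    have [|s [s1 s2]] := pb_lift pbT (q1 := y ∘ l) (q2 := p1 ∘ v); first by cat.
    by rewrite (k2 D' l v s) ?(k2' D' l v' s) //; cat.
  have gU : phi ∘ g = t.
    by apply: P_ext => D y PD; have [k kE [k1 _]] := gP D y PD; cat.
  have [|u [u1 u2]] := pb_lift pbF (q1 := g ∘ t1) (q2 := t2); first by cat.
  exists g, u; split=> //; apply: P_ext => D s PD.
  have [k kE [k1 k2]] := gP D (t1 ∘ s) PD.
  have [|v0 [e1 e2]] := pb_lift pb (q1 := t2 ∘ s) (q2 := k); first by cat.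
  rewrite -compA (evE D (u ∘ s) v0 PD); [|by cat|by cat].
  by apply: (k2 D (id1 D)); rewrite ?comp_id1r.
move=> T TA t1 t2 g g' u u' pbT gg' u1 u2 u1' u2' uu'; have sqT := pbT.1.
apply: P_ext => D y PD.
(* Representatives of [g ∘ y] and [g' ∘ y] take the values of [ev ∘ u] and [ev ∘ u'], which agree,
   so [qP] identifies their classes. *)
have [k kE] := lq D (g ∘ y) PD; have [k' kE'] := lq D (g' ∘ y) PD.
rewrite -kE -kE'; apply/qP; split=> [|D' l v v' PD' e1 e2 e3]; first by cat.
have [|s [s1 s2]] := pb_lift pbT (q1 := y ∘ l) (q2 := p1 ∘ v); first by cat.
have <- : ev ∘ (u ∘ s) = e ∘ v by apply: evE => //; cat.
have <- : ev ∘ (u' ∘ s) = e ∘ v' by apply: evE => //; cat.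
by cat.
Qed.

End FromWeakDependentProducts.

End ProjectiveCover.

Theorem theorem4p17 (E : category) (P : E -> Prop)
    (exactE : exact E) (coverP : projective_cover P) :
  let a := slice_projectives_internally_projective P in
  let b := has_pullbacks (projectives E) in
  let c := weak_pullbacks_have_idempotents (full_subcategory P) in
  ((a <-> b) /\ (b <-> c)) /\
  (a \/ b \/ c ->
   (locally_cartesian_closed E <->
    has_weak_dependent_products (full_subcategory P))).
Proof.
move=> a b c.
have aK := slice_internally_projective_iff exactE coverP.
have bK := projectives_pullbacks exactE coverP.
have cK := idempotents_iff exactE coverP.
split; first by split; [exact: iff_trans aK (iff_sym bK) |
                        exact: iff_trans bK (iff_sym cK)].
move=> abc; have KP : P_pullbacks_projective P.
  by case: abc => [/aK|[/bK|/cK]].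
split=> [lcc|/(weak_dependent_products_iff exactE coverP) wdp].
  apply/(weak_dependent_products_iff exactE coverP).
  exact: weak_dependent_products_of_slice_exponentials.
apply/(locally_cartesian_closed_iff exactE) => U A B f g.
exact: (slice_exponential exactE coverP KP wdp).
Qed.
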